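(* Let $1\le j\le n-1$ and let $O\subseteq Q$ be an order ideal of the type $(A_{n-1},j)$ poset $Q$ described in the context. An $\oplus$-diagram $D$ of shape $O$ is a $\Gamma$-diagram if and only if there is no box $z\in O$ with $D(z)=0$ such that some box below $z$ (same column, larger row index) contains a $+$ and some box to the left of $z$ (same row, smaller column index) contains a $+$.
   Context: $W=S_n$ is the Weyl group of type $A_{n-1}$ with simple reflections $s_i=(i,i+1)$, $1\le i\le n-1$, length function $\ell$ and Bruhat order $<$. $Q$ is the set of boxes $(r,c)$ with $1\le r\le j$ (rows numbered from top to bottom) and $1\le c\le n-j$ (columns from left to right); box $(r,c)$ carries the label $s_{(r,c)}:=s_{r+c-1}$. The partial order on $Q$ is the transitive closure of $(r,c)\lessdot(r,c+1)$ and $(r,c)\lessdot(r-1,c)$ (a box is smaller than the box to its right and than the box above it); an order ideal is a down-closed subset. An $\oplus$-diagram of shape $O$ is a map $D:O\to\{0,+\}$. Choose a linear extension $b_1,\dots,b_m$ of $O$ (so $b_k<b_l\Rightarrow k<l$) and write $s_{i_t}:=s_{b_{m+1-t}}$, so that $s_{i_1}\cdots s_{i_m}=s_{b_m}\cdots s_{b_1}$ (a reduced word). The subexpression of $D$ is $t_1\cdots t_m$ with $t_t=s_{i_t}$ if $D(b_{m+1-t})=0$ and $t_t=1$ if $D(b_{m+1-t})=+$; set $v_{(0)}=1$, $v_{(k)}=t_1\cdots t_k$, $v(D)=v_{(m)}$. $D$ is called a $\Gamma$-diagram if $v_{(k-1)}<v_{(k-1)}s_{i_k}$ for all $k=1,\dots,m$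 (a positive distinguished subexpression); this notion does not depend on the chosen linear extension. *)

(* Defs.v *)
From mathcomp Require Import all_boot all_fingroup zify.

Set Implicit Arguments.
Unset Strict Implicit.
Unset Printing Implicit Defensive.

Local Open Scope group_scope.

(** * The Coxeter group [S_n]

    All indices are 0-based: [simple_refl i] exchanges [i] and [i+1], i.e. it is
    [s_(i+1)] in 1-based notation.  Products in ['S_n] compose from left to
    right; with either convention [('S_n, s_i)] is the same Coxeter system, up
    to the isomorphism [w |-> w^-1]. *)

Lemma adj_ltn0 n (i : 'I_n.-1) : (i < n)%N.
Proof. by have := ltn_ord i; lia. Qed.

Lemma adj_ltn1 n (i : 'I_n.-1) : (i.+1 < n)%N.
Proof. by have := ltn_ord i; lia. Qed.

Definition simple_refl n (i : 'I_n.-1) : 'S_n :=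
  tperm (Ordinal (adj_ltn0 i)) (Ordinal (adj_ltn1 i)).

Definition word_prod n (s : seq 'I_n.-1) : 'S_n :=
  \prod_(i <- s) simple_refl i.

Definition has_word n (w : 'S_n) (k : nat) : bool :=
  [exists s : k.-tuple 'I_n.-1, word_prod s == w].

Lemma tperm_word n (d : nat) (x y : 'I_n) :
  (y = x + d.+1 :> nat)%N -> exists s, tperm x y = word_prod s.
Proof.
elim: d y => [|d IHd] y dy.
  have lt_x : (x < n.-1)%N by have := ltn_ord y; lia.
  exists [:: Ordinal lt_x]; rewrite /word_prod big_seq1 /simple_refl.
  by congr tperm; apply: val_inj => //=; lia.
have lt_y : (y.-1 < n.-1)%N by have := ltn_ord y; lia.
pose i := Ordinal lt_y; pose y' := Ordinal (adj_ltn0 i).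
have Ey : y = Ordinal (adj_ltn1 i) by apply: val_inj => /=; lia.
have [|s Es] := IHd y'; first by rewrite /=; lia.
exists (i :: s ++ [:: i]); rewrite /word_prod big_cons big_cat big_seq1 /=.
rewrite -/(word_prod s) -Es.
have -> : simple_refl i = tperm y' y by rewrite Ey.
rewrite -{1}[tperm y' y]tpermV -conjgE tpermJ tpermL tpermD //;
  by rewrite -(inj_eq val_inj) /=; lia.
Qed.

Lemma has_word_exists n (w : 'S_n) : exists k, has_word w k.
Proof.
suff [s ->] : exists s, w = word_prod s.
  by exists (size s); apply/existsP; exists (in_tuple s); apply/eqP.
have [ts -> dts] := prod_tpermP w; elim: ts dts => [|[x y] ts IHts] /=.
  by move=> _; exists [::]; rewrite /word_prod !big_nil.
case/andP=> nxy /IHts[s Es]; rewrite big_cons Es /=.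
suff [t ->] : exists t, tperm x y = word_prod t.
  by exists (t ++ s); rewrite /word_prod big_cat.
rewrite /dpair /= -(inj_eq val_inj) /= neq_ltn in nxy.
case/orP: nxy => lt_xy; last rewrite tpermC.
  by apply: (@tperm_word _ (y - x).-1); lia.
by apply: (@tperm_word _ (x - y).-1); lia.
Qed.

Definition coxeter_length n (w : 'S_n) : nat := ex_minn (has_word_exists w).

Definition is_reflection n (t : 'S_n) : bool :=
  [exists i : 'I_n.-1, exists w : 'S_n, t == simple_refl i ^ w].

Definition bruhat_step n (u w : 'S_n) : bool :=
  is_reflection (u^-1 * w) && (coxeter_length u < coxeter_length w)%N.

Definition bruhat_lt n (u w : 'S_n) : bool :=
  (u != w) && connect (@bruhat_step n) u w.

(** * The poset [Q]

    [z.1] is the row (numbered from top to bottom) and [z.2] the column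
    (numbered from left to right), both 0-based. *)

Notation box n j := ('I_j * 'I_(n - j))%type.

Definition box_cover n j (x y : box n j) : bool :=
     (x.1 == y.1) && (y.2 == x.2.+1 :> nat)
  || (x.1 == y.1.+1 :> nat) && (x.2 == y.2).

Definition box_le n j : rel (box n j) := connect (@box_cover n j).

Definition box_lt n j (x y : box n j) : bool := (x != y) && box_le x y.

Lemma box_label_subproof n j (z : box n j) : (z.1 + z.2 < n.-1)%N.
Proof. by have := ltn_ord z.1; have := ltn_ord z.2; lia. Qed.

(* The 1-based index [r + c - 1] becomes [r + c] with 0-based [r], [c]. *)
Definition box_refl n j (z : box n j) : 'S_n :=
  simple_refl (Ordinal (box_label_subproof z)).

Definition order_ideal n j (O : {set box n j}) : Prop :=
  forall x y : box n j, box_le x y -> y \in O -> x \in O.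

Notation boxes_of O := {z | z \in O}.

Definition linear_extension n j (O : {set box n j}) m
    (b : m.-tuple (boxes_of O)) : Prop :=
  [/\ uniq b, forall z : boxes_of O, z \in b
    & forall k l : 'I_m,
        box_lt (val (tnth b k)) (val (tnth b l)) -> (k < l)%N].

(** * Diagrams *)

Variant entry := Zero | Plus.

Definition oplus_diagram n j (O : {set box n j}) := boxes_of O -> entry.

Definition factor n j (O : {set box n j}) (D : oplus_diagram O)
    (z : boxes_of O) : 'S_n :=
  match D z with Zero => box_refl (val z) | Plus => 1 end.

(* [rev b] lists the boxes in the order of the word [s_(b_m) ... s_(b_1)]. *)
Definition partial_prod n j (O : {set box n j}) m
    (b : m.-tuple (boxes_of O)) (D : oplus_diagram O) (k : nat) : 'S_n :=
  \prod_(z <- take k (rev b)) factor D z.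

(* As [k] is 0-based, [v] is the product of the factors preceding the letter
   [tnth (rev_tuple b) k]. *)
Definition Gamma_diagram n j (O : {set box n j}) m
    (b : m.-tuple (boxes_of O)) (D : oplus_diagram O) : Prop :=
  forall k : 'I_m,
    let v := partial_prod b D k in
    bruhat_lt v (v * box_refl (val (tnth (rev_tuple b) k))).

Definition is_below n j (y z : box n j) : bool :=
  (y.2 == z.2) && (z.1 < y.1)%N.

Definition is_left_of n j (x z : box n j) : bool :=
  (x.1 == z.1) && (x.2 < z.2)%N.

(* Main.v *)
(** Draw two strands in each box: a [Zero] is a crossing (top to bottom, right to
    left), a [Plus] a pair of elbows (top to left, right to bottom).  Reading the
    word traces [n] wires travelling down and left and, by the exchange property,
    [v < v s] at a letter says that in its box the wire coming from the top has a
    smaller number than the one coming from the right.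

    Suppose that this holds in every box.  Then the wires met at the bottom edges
    of the boxes of a column can only grow downwards, and those met at the left
    edges of the boxes of a row can only decrease leftwards.  If [z] is [Zero], its
    top wire [p] goes straight down to the first [Plus] [y] below [z] and its right
    wire [q > p] straight left to the first [Plus] [x] on the left of [z].  In the
    box at the corner opposite to [z] the top wire is then at least [q] and the
    right wire at most [p], a contradiction.

    Conversely, if the wires meeting in a box are in the wrong order, they have
    crossed in an earlier box [z].  Had one of them met no [Plus] on the straight
    line along which it left [z], it would never leave this line, and the two wires
    would not meet again; so there are both a [Plus] below [z] and a [Plus] on the
    left of [z]. *)

Require Import Defs.
From mathcomp Require Import all_boot all_fingroup zify.

Set Implicit Arguments.
Unset Strict Implicit.
Unset Printing Implicit Defensive.

(** * Bruhat comparison with a simple reflection *)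

Section SimpleReflections.

Local Open Scope group_scope.

Variable n : nat.
Implicit Types (i : 'I_n.-1) (s : seq 'I_n.-1) (x y : 'I_n) (u w : 'S_n).

Lemma simple_reflE i x :
  simple_refl i x = (if x == i :> nat then i.+1
                     else if x == i.+1 :> nat then i : nat else x) :> nat.
Proof.
rewrite /simple_refl permE /= -!(inj_eq val_inj) /=.
by do 2![case: ifP => //= _].
Qed.

Lemma simple_reflK i w : w * simple_refl i * simple_refl i = w.
Proof. by rewrite -mulgA tperm2 mulg1. Qed.

Lemma ltn_simple_refl i x y :
    (x < y)%N ->
  (simple_refl i x < simple_refl i y)%N
    = ~~ ((x == Ordinal (adj_ltn0 i)) && (y == Ordinal (adj_ltn1 i))).
Proof.
rewrite !simple_reflE -!val_eqE /=.
by do 4?case: ifP; lia.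
Qed.

Lemma word_prod_rcons s i : word_prod (rcons s i) = word_prod s * simple_refl i.
Proof. by rewrite /word_prod big_rcons. Qed.

(* The exchange property, stated for all transpositions so that the induction
   on the word goes through. *)
Lemma word_exchange s x y :
    (x < y)%N -> ((word_prod s)^-1 y < (word_prod s)^-1 x)%N ->
  exists2 s', (size s' < size s)%N & word_prod s' = word_prod s * tperm x y.
Proof.
elim/last_ind: s x y => [|s i IHs] x y lt_xy.
  by rewrite /word_prod big_nil invg1 !perm1; lia.
rewrite word_prod_rcons size_rcons invMg !permM tpermV -/(simple_refl i) => lt_yx.
have [/andP[/eqP-> /eqP->]|] :=
    boolP ((x == Ordinal (adj_ltn0 i)) && (y == Ordinal (adj_ltn1 i))).
  by exists s => //; rewrite -/(simple_refl i) simple_reflK.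
rewrite -ltn_simple_refl // => /IHs/(_ lt_yx)[s' lt_s' Es'].
exists (rcons s' i); first by rewrite size_rcons.
rewrite word_prod_rcons Es' -!mulgA; congr (_ * _).
by rewrite -tpermJ conjgE tpermV -/(simple_refl i) !mulgA simple_reflK.
Qed.

Lemma coxeter_length_word w :
  exists2 s, word_prod s = w & size s = coxeter_length w.
Proof.
rewrite /coxeter_length; case: ex_minnP => k /existsP[s /eqP Es] _.
by exists s; rewrite ?size_tuple.
Qed.

Lemma coxeter_length_le s : (coxeter_length (word_prod s) <= size s)%N.
Proof.
rewrite /coxeter_length; case: ex_minnP => k _; apply.
by apply/existsP; exists (in_tuple s).
Qed.

Lemma coxeter_length_tperm w x y :
    (x < y)%N -> (w^-1 y < w^-1 x)%N ->
  (coxeter_length (w * tperm x y) < coxeter_length w)%N.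
Proof.
have [s <- <-] := coxeter_length_word w => lt_xy /(word_exchange lt_xy)[s' lt_s' <-].
exact: leq_ltn_trans (coxeter_length_le s') lt_s'.
Qed.

Lemma connect_bruhat_length u w :
  connect (@bruhat_step n) u w -> (coxeter_length u <= coxeter_length w)%N.
Proof.
case/connectP=> p + ->; elim: p u => //= v p IHp u /andP[/andP[_ lt_uv] /IHp].
exact/leq_trans/ltnW.
Qed.

Lemma bruhat_lt_simple w i :
  bruhat_lt w (w * simple_refl i) =
  (w^-1 (Ordinal (adj_ltn0 i)) < w^-1 (Ordinal (adj_ltn1 i)))%N.
Proof.
case: ltnP => [lt_w|].
  have lt_l : (coxeter_length w < coxeter_length (w * simple_refl i))%N.
    rewrite -{1}(simple_reflK i w); apply: coxeter_length_tperm => //.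
    by rewrite invMg !permM tpermV tpermL tpermR.
  apply/andP; split; first by apply: contraTneq lt_l => <-; rewrite ltnn.
  apply: connect1; rewrite /bruhat_step lt_l andbT mulKg.
  by apply/existsP; exists i; apply/existsP; exists 1; rewrite conjg1.
rewrite leq_eqVlt => /orP[/eqP/val_inj/perm_inj/(congr1 val)/= |lt_w]; first lia.
have: (coxeter_length (w * simple_refl i) < coxeter_length w)%N.
  exact: coxeter_length_tperm.
by apply: contraTF => /andP[_ /connect_bruhat_length]; rewrite leqNgt.
Qed.

End SimpleReflections.

(** * Boxes and directions *)

Lemma box_leE n j (x y : box n j) :
  box_le x y = (y.1 <= x.1) && (x.2 <= y.2).
Proof.
apply/idP/idP => [/connectP[p + ->]|].
  elim: p x => [|u p IHp] x /=; first by rewrite !leqnn.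
  by case/andP=> + /IHp /andP[]; rewrite /box_cover -!val_eqE /=; lia.
have [d] := ubnP (x.1 - y.1 + (y.2 - x.2)); elim: d x => // d IHd [r c] /= lt_d.
case/andP=> le_r le_c; have [Er|neq_r] := eqVneq (y.1 : nat) r; last first.
  have lt_r : r.-1 < j by have := ltn_ord r; lia.
  apply: connect_trans (IHd (Ordinal lt_r, c) _ _); rewrite /=; try lia.
  by apply: connect1; rewrite /box_cover /= eqxx; lia.
have [Ec|neq_c] := eqVneq (c : nat) y.2.
  suff -> : (r, c) = y by apply: connect0.
  by rewrite [y]surjective_pairing; congr pair; apply: val_inj.
have lt_c : c.+1 < n - j by have := ltn_ord y.2; lia.
apply: connect_trans (IHd (r, Ordinal lt_c) _ _); rewrite /=; try lia.
by apply: connect1; rewrite /box_cover /= eqxx; lia.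
Qed.

Variant direction := Down | Left.

Definition turn (d : direction) : direction :=
  match d with Down => Left | Left => Down end.

Section Directions.

Variables n j : nat.
Implicit Types (d : direction) (z y x : box n j).

Definition next_box d z y : bool :=
  match d with
  | Down => (y.2 == z.2 :> nat) && (y.1 == z.1.+1 :> nat)
  | Left => (y.1 == z.1 :> nat) && (z.2 == y.2.+1 :> nat)
  end.

Definition beyond d z y : bool :=
  match d with Down => z.1 < y.1 | Left => y.2 < z.2 end.

Definition ahead d z y : bool :=
  match d with Down => is_below y z | Left => is_left_of y z end.

(* The points exchanged by [box_refl z] number the edges of [z]: the smaller one
   its top and left edges, the larger one its right and bottom edges. *)
Definition inlet d z : 'I_n :=
  let i := Ordinal (box_label_subproof z) in
  match d with
  | Down => Ordinal (adj_ltn0 i)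
  | Left => Ordinal (adj_ltn1 i)
  end.

Definition outlet d z : 'I_n := inlet (turn d) z.

Lemma next_box_inlet d z y : next_box d z y -> inlet d y = outlet d z.
Proof. by case: d => /= next_y; apply: val_inj => /=; lia. Qed.

Lemma next_box_unique d z y x : next_box d z y -> next_box d z x -> y = x.
Proof.
move=> next_y next_x; apply/eqP; rewrite -pair_eqE /= -!val_eqE /=.
by case: d next_y next_x => /=; lia.
Qed.

Lemma outlet_neq_inlet d z : outlet d z != inlet d z.
Proof. by rewrite -val_eqE; case: d => /=; lia. Qed.

Lemma next_box_ahead d z y : next_box d z y -> ahead d z y.
Proof. by case: d; rewrite /= /is_below /is_left_of -!val_eqE /=; lia. Qed.

Lemma ahead_next_box d z x y :
  next_box d z x -> ahead d z y -> x = y \/ ahead d x y.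
Proof.
have [->|neq_xy next_x ahead_y] := eqVneq x y; [by left | right].
move: neq_xy next_x ahead_y; rewrite -pair_eqE /= -!val_eqE /=.
by case: d; rewrite /= /is_below /is_left_of -!val_eqE /=; lia.
Qed.

Lemma ahead_beyond d z y : ahead d z y -> beyond d z y.
Proof. by case: d => /andP[]. Qed.

Lemma ahead_trans d : transitive (ahead d).
Proof. by move=> y z x; case: d; rewrite /= /is_below /is_left_of -!val_eqE /=; lia. Qed.

Lemma box_refl_inlet d z : box_refl z (inlet d z) = outlet d z.
Proof. by case: d; rewrite /box_refl ?tpermL ?tpermR. Qed.

End Directions.

(** * Reading the boxes of an order ideal *)

Section Reading.

Variables (n j : nat) (O : {set box n j}).
Variables (m : nat) (b : m.-tuple (boxes_of O)).
Implicit Types (d : direction) (z y x u : boxes_of O) (p q : 'I_n) (t : nat).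

Definition read_time z : nat := index z (rev b).

Hypothesis hO : order_ideal O.
Hypothesis hb : linear_extension b.

Lemma read_time_nth_rev z t : t < m -> read_time (nth z (rev b) t) = t.
Proof.
have [uniq_b _ _] := hb => lt_tm.
by rewrite /read_time index_uniq ?rev_uniq // size_rev size_tuple.
Qed.

Lemma mem_rev_extension z : z \in rev b.
Proof. by have [_ all_b _] := hb; rewrite mem_rev; apply: all_b. Qed.

Lemma nth_rev_read_time y z : nth y (rev b) (read_time z) = z.
Proof. exact/nth_index/mem_rev_extension. Qed.

Lemma read_time_lt z : read_time z < m.
Proof. by rewrite -[m](size_tuple (rev_tuple b)) index_mem mem_rev_extension. Qed.

Lemma read_time_surj t : t < m -> exists z, read_time z = t.
Proof.
move=> lt_tm; pose z := tnth (rev_tuple b) (Ordinal lt_tm).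
by exists z; rewrite [z](tnth_nth z) read_time_nth_rev.
Qed.

Lemma read_time_inj : injective read_time.
Proof. by move=> z y Ezy; rewrite -(nth_rev_read_time z z) Ezy nth_rev_read_time. Qed.

Lemma read_time_le z y :
  (val z).1 <= (val y).1 -> (val y).2 <= (val z).2 -> read_time z <= read_time y.
Proof.
have [_ all_b mono_b] := hb; have [-> //|neq_zy le1 le2] := eqVneq z y.
have /tnthP[k Ez] := all_b z; have /tnthP[l Ey] := all_b y.
have read_time_tnth i : read_time (tnth b i) = rev_ord i.
  rewrite -[RHS](read_time_nth_rev z) ?nth_rev ?size_tuple ?ltn_ord //=.
  by rewrite subnSK // subKn ?(tnth_nth z) // ltnW.
have lt_lk : l < k.
  by apply: mono_b; rewrite -Ez -Ey /box_lt box_leE (inj_eq val_inj) eq_sym neq_zy le1.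
by rewrite Ez Ey !read_time_tnth /=; lia.
Qed.

Lemma ideal_box z (r : 'I_j) (c : 'I_(n - j)) :
  (val z).1 <= r -> c <= (val z).2 -> exists y, val y = (r, c).
Proof.
move=> le_r le_c; suff Orc : (r, c) \in O by exists (exist _ (r, c) Orc).
by apply: hO (valP z); rewrite box_leE le_r.
Qed.

Lemma exists_next_box d z (y : box n j) :
  beyond d (val z) y -> exists x, next_box d (val z) (val x).
Proof.
case: d => /= lt_zy.
  have lt_r := leq_ltn_trans lt_zy (ltn_ord y.1).
  have [//=|//|x Ex] := @ideal_box z (Ordinal lt_r) (val z).2.
  by exists x; rewrite Ex /= !eqxx.
have lt_c : (val z).2.-1 < n - j by have := ltn_ord (val z).2; lia.
have [//|/=|x Ex] := @ideal_box z (val z).1 (Ordinal lt_c); first by lia.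
by exists x; rewrite Ex /= eqxx; lia.
Qed.

Lemma read_time_next_box d z y : next_box d (val z) (val y) -> read_time z < read_time y.
Proof.
move=> next_y; rewrite ltn_neqAle (inj_eq read_time_inj); apply/andP; split.
  by apply: contraTneq next_y => ->; case: d => /=; lia.
by apply: read_time_le; case: d next_y => /=; lia.
Qed.

Lemma read_time_ahead d z y : ahead d (val z) (val y) -> read_time z <= read_time y.
Proof.
by case: d => /andP[/eqP eq_zy /ltnW le_zy]; apply: read_time_le; rewrite ?eq_zy.
Qed.

Lemma ahead_ind d y (P : boxes_of O -> Prop) :
    (forall z, next_box d (val z) (val y) -> P z) ->
    (forall z x, next_box d (val z) (val x) -> ahead d (val x) (val y) -> P x -> P z) ->
  forall z, ahead d (val z) (val y) -> P z.
Proof.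
move=> Pnext Pstep z; have [k] := ubnP (read_time y - read_time z).
elim: k z => // k IHk z lt_k ahead_y.
have [x next_x] : exists x, next_box d (val z) (val x).
  exact/exists_next_box/ahead_beyond/ahead_y.
have [/val_inj Ex|ahead_x] := ahead_next_box next_x ahead_y.
  by apply: Pnext; rewrite -Ex.
apply: (Pstep z x) => //; apply: IHk => //.
by have := read_time_next_box next_x; have := read_time_ahead ahead_x; lia.
Qed.

(* So no letter moves the point [outlet d z] between [z] and the next box. *)
Lemma outlet_read_next_box d e z u :
    read_time z < read_time u -> inlet e (val u) = outlet d (val z) ->
  exists2 x, next_box d (val z) (val x) & read_time x <= read_time u.
Proof.
move=> lt_zu /(congr1 val) Eu.
have not_le : ~~ (((val u).1 <= (val z).1) && ((val z).2 <= (val u).2)).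
  by apply: contraTN lt_zu => /andP[le1 le2]; rewrite -leqNgt read_time_le.
have [x next_x] : exists x, next_box d (val z) (val x).
  by apply: (@exists_next_box _ _ (val u)); move: not_le Eu; case: d e => [] [] /=; lia.
exists x => //; apply: read_time_le;
  by move: not_le Eu next_x; case: d e => [] [] /=; lia.
Qed.

(** * Wires *)

Variable D : oplus_diagram O.

(* After [t] letters wire [p] is at the point [partial_prod b D t p]. *)
Definition wire_in d z : 'I_n :=
  (partial_prod b D (read_time z))^-1%g (inlet d (val z)).

Definition wire_out d z : 'I_n :=
  match D z with Zero => wire_in d z | Plus => wire_in (turn d) z end.

Lemma wire_out_Zero d z : D z = Zero -> wire_out d z = wire_in d z.
Proof. by rewrite /wire_out => ->. Qed.

Lemma wire_out_Plus d z : D z = Plus -> wire_out d z = wire_in (turn d) z.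
Proof. by rewrite /wire_out => ->. Qed.

Lemma partial_prod_in d z :
  partial_prod b D (read_time z) (wire_in d z) = inlet d (val z).
Proof. exact: permKV. Qed.

Lemma wire_in_eq d z p :
  partial_prod b D (read_time z) p = inlet d (val z) -> p = wire_in d z.
Proof. by move=> Ep; rewrite /wire_in -Ep permK. Qed.

Lemma partial_prodS z p :
  partial_prod b D (read_time z).+1 p = factor D z (partial_prod b D (read_time z) p).
Proof.
rewrite /partial_prod (take_nth z) ?index_mem ?mem_rev_extension //.
by rewrite nth_rev_read_time big_rcons permM.
Qed.

Lemma partial_prod_out d z :
  partial_prod b D (read_time z).+1 (wire_out d z) = outlet d (val z).
Proof.
rewrite partial_prodS /factor /wire_out; case: (D z); rewrite partial_prod_in.
  exact: box_refl_inlet.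
exact: perm1.
Qed.

Lemma factor_id z (x : 'I_n) :
  (forall d, inlet d (val z) != x) -> factor D z x = x.
Proof.
move=> neq; rewrite /factor; case: (D z); last exact: perm1.
by rewrite [box_refl _ _]tpermD // (neq Down, neq Left).
Qed.

Lemma partial_prod_out_stable d z t :
    read_time z < t <= m ->
    (forall x, next_box d (val z) (val x) -> t <= read_time x) ->
  partial_prod b D t (wire_out d z) = outlet d (val z).
Proof.
elim: t => // t IHt /andP[lt_zt lt_tm] late.
have [<-|neq_zt] := eqVneq (read_time z) t; first exact: partial_prod_out.
have {}lt_zt : read_time z < t by lia.
have [u Et] := read_time_surj lt_tm.
rewrite -Et partial_prodS Et IHt //; first last.
- by move=> x /late/ltnW.
- by rewrite lt_zt ltnW.
apply: factor_id => e; apply/eqP; rewrite -Et in lt_zt.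
case/(outlet_read_next_box lt_zt) => x /late; lia.
Qed.

Lemma wire_in_next_box d z y :
  next_box d (val z) (val y) -> wire_in d y = wire_out d z.
Proof.
move=> next_y; apply/esym/wire_in_eq; rewrite (next_box_inlet next_y).
apply: partial_prod_out_stable.
  by rewrite (read_time_next_box next_y) ltnW ?read_time_lt.
by move=> x next_x; rewrite (val_inj (next_box_unique next_y next_x)).
Qed.

Lemma wire_in_turn_neq d z : wire_in (turn d) z != wire_in d z.
Proof. by rewrite /wire_in (inj_eq perm_inj) outlet_neq_inlet. Qed.

Lemma reentry_read_next_box d e z u :
    read_time z < read_time u -> wire_out d z = wire_in e u ->
  exists2 x, next_box d (val z) (val x) & read_time x <= read_time u.
Proof.
move=> lt_zu Ew.
have [/existsP[x /andP[next_x le_xu]]|/existsPn not_yet] :=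
    boolP [exists x, next_box d (val z) (val x) && (read_time x <= read_time u)].
  by exists x.
apply: (outlet_read_next_box (e := e)) => //; rewrite -partial_prod_in -Ew.
apply: partial_prod_out_stable => [|x next_x]; first by rewrite lt_zu ltnW ?read_time_lt.
by have := not_yet x; rewrite next_x -ltnNge => /ltnW.
Qed.

Definition ordered_wires : Prop := forall z, wire_in Down z < wire_in Left z.

Lemma Gamma_diagramP : Gamma_diagram b D <-> ordered_wires.
Proof.
rewrite /ordered_wires /wire_in; split=> [G z | lt_wires k /=].
  have /= := G (Ordinal (read_time_lt z)).
  by rewrite (tnth_nth z) nth_rev_read_time bruhat_lt_simple.
have := lt_wires (tnth (rev_tuple b) k); rewrite bruhat_lt_simple.
by rewrite (tnth_nth (tnth b k)) read_time_nth_rev.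
Qed.

Lemma crossing_exists t p q :
    t <= m -> p < q -> partial_prod b D t q < partial_prod b D t p ->
  exists z, [/\ read_time z < t, D z = Zero, p = wire_in Down z & q = wire_in Left z].
Proof.
elim: t => [|t IHt] lt_tm lt_pq.
  by rewrite /partial_prod take0 big_nil !perm1; lia.
have [u Et] := read_time_surj lt_tm.
case: (ltngtP (partial_prod b D t p) (partial_prod b D t q)) => [lt_t|gt_t _|].
- rewrite -Et !partial_prodS Et /factor; case Du: (D u); last by rewrite !perm1; lia.
  rewrite ltnNge leq_eqVlt ltn_simple_refl // negb_or negbK.
  case/and3P=> _ /eqP Ep /eqP Eq; exists u.
  by rewrite Et ltnSn; split=> //; apply: wire_in_eq; rewrite Et ?Ep ?Eq.
- have [u' [lt_u' Du' Ep Eq]] := IHt (ltnW lt_tm) lt_pq gt_t.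
  by exists u'; split=> //; apply: ltnW.
- by move/val_inj/perm_inj => Epq; move: lt_pq; rewrite Epq ltnn.
Qed.

Lemma wire_out_first_Plus d z y :
    ahead d (val z) (val y) -> D y = Plus ->
  exists x, [/\ ahead d (val z) (val x), D x = Plus & wire_in d x = wire_out d z].
Proof.
move=> ahead_y Dy; move: z ahead_y.
apply: ahead_ind => [z next_y|z x next_x _ [w [ahead_w Dw Ew]]].
  by exists y; split=> //; [exact: next_box_ahead | exact: wire_in_next_box].
have ahead_x := next_box_ahead next_x; have Ex := wire_in_next_box next_x.
case Dx: (D x); last by exists x.
exists w; split=> //; first exact: ahead_trans ahead_w.
by rewrite Ew wire_out_Zero.
Qed.

Lemma Plus_ahead_of_meeting d z u :
    read_time z < read_time u -> wire_out d z = wire_in (turn d) u ->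
  exists2 y, ahead d (val z) (val y) & D y = Plus.
Proof.
have [k] := ubnP (read_time u - read_time z); elim: k z => // k IHk z lt_k lt_zu meet.
have [x next_x le_xu] := reentry_read_next_box lt_zu meet.
have ahead_x := next_box_ahead next_x; have Ex := wire_in_next_box next_x.
case Dx: (D x); last by exists x.
have lt_xu : read_time x < read_time u.
  rewrite ltn_neqAle le_xu andbT (inj_eq read_time_inj); apply/eqP => Exu.
  by have := wire_in_turn_neq d u; rewrite -meet -Ex Exu eqxx.
have [||y ahead_y Dy] := IHk x _ lt_xu.
- by have := read_time_next_box next_x; lia.
- by rewrite wire_out_Zero // Ex.
by exists y => //; apply: ahead_trans ahead_y.
Qed.

Lemma wire_ahead_rel (R : rel 'I_n) d z y :
    reflexive R -> transitive R -> (forall x, R (wire_in d x) (wire_out d x)) ->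
  ahead d (val z) (val y) -> R (wire_out d z) (wire_in d y).
Proof.
move=> refl_R trans_R R_box ahead_y.
move: z ahead_y; apply: ahead_ind => [z next_y|z x next_x _].
  by rewrite (wire_in_next_box next_y).
by apply: trans_R; rewrite -(wire_in_next_box next_x).
Qed.

Lemma leq_wire_down z y :
    ordered_wires -> ahead Down (val z) (val y) ->
  wire_out Down z <= wire_in Down y.
Proof.
move=> lt_wires; apply: (@wire_ahead_rel leq) => [p|p q r|x] //; first exact: leq_trans.
by rewrite /wire_out; case: (D x) => //; apply/ltnW/lt_wires.
Qed.

Lemma leq_wire_left z y :
    ordered_wires -> ahead Left (val z) (val y) ->
  wire_in Left y <= wire_out Left z.
Proof.
move=> lt_wires.
apply: (@wire_ahead_rel (fun p q => q <= p)) => [p|p q r le_pq le_qr|x] //.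
  exact: leq_trans le_pq.
by rewrite /wire_out; case: (D x) => //; apply/ltnW/lt_wires.
Qed.

Definition flanked z : Prop :=
  forall d, exists2 y, ahead d (val z) (val y) & D y = Plus.

Lemma Zero_not_flanked z : ordered_wires -> D z = Zero -> ~ flanked z.
Proof.
move=> lt_wires Dz flanked_z.
have [y0 ahead_y0 Dy0] := flanked_z Down; have [x0 ahead_x0 Dx0] := flanked_z Left.
have [y [ahead_y Dy Ey]] := wire_out_first_Plus ahead_y0 Dy0.
have [x [ahead_x Dx Ex]] := wire_out_first_Plus ahead_x0 Dx0.
have [/andP[/eqP Ec lt_zy] /andP[/eqP Er lt_xz]] := (ahead_y, ahead_x).
have [||w Ew] := @ideal_box z (val y).1 (val x).2; [exact: ltnW | exact: ltnW |].
have ahead_xw : ahead Down (val x) (val w) by rewrite Ew /= /is_below /= eqxx Er.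
have ahead_yw : ahead Left (val y) (val w) by rewrite Ew /= /is_left_of /= eqxx Ec.
have le_right_down : wire_in Left z <= wire_in Down w.
  by rewrite -(wire_out_Zero Left Dz) -Ex -(wire_out_Plus Down Dx) leq_wire_down.
have le_left_top : wire_in Left w <= wire_in Down z.
  by rewrite -(wire_out_Zero Down Dz) -Ey -(wire_out_Plus Left Dy) leq_wire_left.
by have := lt_wires w; have := lt_wires z; lia.
Qed.

Lemma wrong_order_flanked z :
  wire_in Left z < wire_in Down z -> exists2 u, D u = Zero & flanked u.
Proof.
move=> gt_wires.
have [||u [lt_uz Du EL ED]] := crossing_exists (t := read_time z) _ gt_wires.
- exact/ltnW/read_time_lt.
- by rewrite !partial_prod_in.
exists u => // d; apply: (Plus_ahead_of_meeting lt_uz).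
by rewrite wire_out_Zero //; case: d.
Qed.

Lemma Gamma_diagram_flanked :
  Gamma_diagram b D <-> ~ (exists2 z, D z = Zero & flanked z).
Proof.
rewrite Gamma_diagramP; split=> [lt_wires [z]|no_flanked z].
  exact: Zero_not_flanked.
rewrite ltn_neqAle leqNgt (inj_eq val_inj) (wire_in_turn_neq Left) /=.
by apply/negP => /wrong_order_flanked.
Qed.

End Reading.

Theorem mainTheorem1 (n j : nat) (hj : 1 <= j <= n - 1)
    (O : {set box n j}) (hO : order_ideal O)
    (m : nat) (b : m.-tuple (boxes_of O)) (hb : linear_extension b)
    (D : oplus_diagram O) :
  Gamma_diagram b D <->
  ~ (exists z : boxes_of O,
       [/\ D z = Zero,
           exists y : boxes_of O, is_below (val y) (val z) /\ D y = Plus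
         & exists x : boxes_of O, is_left_of (val x) (val z) /\ D x = Plus]).
Proof.
rewrite (Gamma_diagram_flanked hO hb D).
split=> no_pattern [z].
  move=> [Dz [y [below_y Dy]] [x [left_x Dx]]]; apply: no_pattern; exists z => //.
  by case; [exists y | exists x].
move=> Dz flanked_z; apply: no_pattern; exists z; split=> //.
  by have [y] := flanked_z Down; exists y.
by have [x] := flanked_z Left; exists x.
Qed.
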